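(* Let $M$ be a connected manifold and let $P$ be a principal $\mathrm{SU}(n)$-bundle over $M$. Then any Howe subbundle of $P$ is holonomy-induced; that is, every reduction $Q\subseteq P$ to a Howe subgroup of $\mathrm{SU}(n)$ contains a connected subbundle $\tilde Q\subseteq Q$, with structure group $\tilde H$, such that $Q=\tilde Q\cdot\mathrm{C}^2_{\mathrm{SU}(n)}(\tilde H)$.
   Context: For $K\subseteq G$, $\mathrm{C}_G(K)$ is the centralizer of $K$ in $G$, and $\mathrm{C}_G^2(K)=\mathrm{C}_G(\mathrm{C}_G(K))$. A subgroup $H\subseteq G$ is a Howe subgroup iff $H=\mathrm{C}_G(K)$ for some subset $K\subseteq G$. A Howe subbundle of a principal $G$-bundle $P$ is a reduction (principal subbundle) of $P$ to a Howe subgroup of $G$. Bundles and subbundles are of class $C^0$, and bundle reductions are to Lie subgroups. *)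

(* Defs.v *)
From HB Require Import structures.
From mathcomp Require Import all_boot all_order all_algebra.
From mathcomp Require Import complex.
From mathcomp Require Import all_classical all_reals all_analysis.
Import Order.TTheory GRing.Theory Num.Theory numFieldNormedType.Exports.

Set Implicit Arguments.
Unset Strict Implicit.
Unset Printing Implicit Defensive.

Local Open Scope classical_set_scope.
Local Open Scope group_scope.
Local Open Scope ring_scope.

HB.mixin Record Group_isTopologicalGroup G of Group G & Topological G := {
  mulg_continuous : continuous (fun xy : G * G => xy.1 * xy.2)%g;
  invg_continuous : continuous (fun x : G => x^-1)%g
}.

#[short(type="topologicalGroupType")]
HB.structure Definition TopologicalGroup :=
  {G of Group_isTopologicalGroup G & Group G & Topological G}.

Section SpecialUnitary.
Variables (R : realType) (n : nat).
Local Open Scope sesquilinear_scope.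

Record special_unitary := SpecialUnitary {
  su_mx :> 'M[R[i]]_n;
  su_mxP : (su_mx \is unitarymx) && (\det su_mx == 1)
}.

HB.instance Definition _ := [isSub for su_mx].
HB.instance Definition _ := [Choice of special_unitary by <:].

Fact su_one_subproof :
  ((1%:M : 'M[R[i]]_n) \is unitarymx) && (\det (1%:M : 'M[R[i]]_n) == 1).
Proof.
rewrite det1 eqxx andbT; apply/unitarymxP.
by rewrite trmx1 map_mx1 mulmx1.
Qed.

Fact su_mul_subproof (A B : special_unitary) :
  ((A : 'M[R[i]]_n) *m B \is unitarymx)
  && (\det ((A : 'M[R[i]]_n) *m B) == 1).
Proof.
case: A B => [A /andP[uA /eqP dA]] [B /andP[uB /eqP dB]] /=.
by rewrite mul_unitarymx // det_mulmx dA dB mulr1 eqxx.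
Qed.

Fact su_inv_subproof (A : special_unitary) :
  ((A : 'M[R[i]]_n)^t* \is unitarymx) && (\det ((A : 'M[R[i]]_n)^t*) == 1).
Proof.
case: A => [A /andP[uA /eqP dA]] /=.
rewrite det_map_mx det_tr dA rmorph1 eqxx andbT; apply/unitarymxP.
by rewrite trmxCK; apply: mulmx1C; apply/unitarymxP.
Qed.

Definition su_one := SpecialUnitary su_one_subproof.
Definition su_mul A B := SpecialUnitary (su_mul_subproof A B).
Definition su_inv A := SpecialUnitary (su_inv_subproof A).

Fact su_mulA : associative su_mul.
Proof. by move=> A B C; apply: val_inj; rewrite /= mulmxA. Qed.
Fact su_mul1 : left_id su_one su_mul.
Proof. by move=> A; apply: val_inj; rewrite /= mul1mx. Qed.
Fact su_mulr1 : right_id su_one su_mul.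
Proof. by move=> A; apply: val_inj; rewrite /= mulmx1. Qed.
Fact su_mulrV : right_inverse su_one su_inv su_mul.
Proof.
move=> A; apply: val_inj => /=; apply/unitarymxP.
by case: A => A /= /andP[].
Qed.
Fact su_mulV : left_inverse su_one su_inv su_mul.
Proof.
by move=> A; apply: val_inj; apply: mulmx1C; exact: (congr1 su_mx (su_mulrV A)).
Qed.

HB.instance Definition _ := isGroup.Build special_unitary
  su_mulA su_mul1 su_mulr1 su_mulV su_mulrV.

(* The subspace topology; [R[i]^o] is R[i] with the topology of its modulus. *)
HB.instance Definition _ := Topological.copy special_unitary
  (initial_topology (su_mx : special_unitary -> 'M[R[i]^o]_n)).

End SpecialUnitary.

Section MatrixContinuity.

Lemma mx_continuous (X T : topologicalType) m n (f : X -> 'M[T]_(m, n)) :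
  (forall i j, continuous (fun x => f x i j)) -> continuous f.
Proof.
move=> fc x A [P xP PA].
have : \forall y \near x, forall ij : 'I_m * 'I_n, P ij.1 ij.2 (f y ij.1 ij.2).
  apply: filter_forall => -[i j] /=; exact: (fc i j x _ (xP i j)).
by apply: filterS => y Py; apply: PA => i j; exact: (Py (i, j)).
Qed.

Lemma mx_entry_continuous (T : topologicalType) m n i j :
  continuous (fun A : 'M[T]_(m, n) => A i j).
Proof.
move=> A B AB.
exists (fun k l => if (k == i) && (l == j) then B else setT).
  by move=> k l; case: ifPn => [/andP[/eqP-> /eqP->] //|_]; exact: filterT.
by move=> C /(_ i j); rewrite !eqxx.
Qed.

Lemma conj_continuous (K : numClosedFieldType) :
  continuous (Num.conj : K^o -> K^o).
Proof.
move=> z A [e e0 zA]; exists e => // w zw; apply: zA.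
by rewrite /ball_ /= in zw *; rewrite -rmorphB norm_conjC.
Qed.

Lemma mulmx_continuous (K : numFieldType) m n p :
  continuous (fun AB : 'M[K^o]_(m, n) * 'M[K^o]_(n, p) => AB.1 *m AB.2).
Proof.
apply: mx_continuous => i j.
have -> : (fun AB : 'M[K^o]_(m, n) * 'M[K^o]_(n, p) => (AB.1 *m AB.2) i j) =
    (fun AB => \sum_k AB.1 i k * AB.2 k j) by apply/funext => AB; rewrite mxE.
apply: continuous_big => [|k _ AB]; first exact: (@add_continuous K^o).
apply: cvgM.
- by apply: (cvg_comp (fun AB : _ * _ => AB.1) (fun A : 'M[K^o]_(m, n) => A i k));
    [exact: cvg_fst | exact: mx_entry_continuous].
- by apply: (cvg_comp (fun AB : _ * _ => AB.2) (fun A : 'M[K^o]_(n, p) => A k j));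
    [exact: cvg_snd | exact: mx_entry_continuous].
Qed.

End MatrixContinuity.

Section SpecialUnitaryTopology.
Variables (R : realType) (n : nat).
Local Open Scope sesquilinear_scope.
Local Notation SU := (special_unitary R n).

Lemma su_mx_continuous : continuous (@su_mx R n : SU -> 'M[R[i]^o]_n).
Proof. exact: initial_continuous. Qed.

Fact su_mul_continuous : continuous (fun AB : SU * SU => AB.1 * AB.2)%g.
Proof.
apply: (@continuous_comp_initial _ _ _ (@su_mx R n : SU -> 'M[R[i]^o]_n)).
have c1 : continuous (fun AB : SU * SU => su_mx AB.1 : 'M[R[i]^o]_n).
  by move=> AB; apply: continuous_comp;
    [exact: cvg_fst | exact: su_mx_continuous].
have c2 : continuous (fun AB : SU * SU => su_mx AB.2 : 'M[R[i]^o]_n).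
  by move=> AB; apply: continuous_comp;
    [exact: cvg_snd | exact: su_mx_continuous].
move=> AB; apply: continuous2_cvg (c1 AB) (c2 AB).
exact: (@mulmx_continuous R[i] n n n (_, _)).
Qed.

Fact su_inv_continuous : continuous (fun A : SU => A^-1)%g.
Proof.
apply: (@continuous_comp_initial _ _ _ (@su_mx R n : SU -> 'M[R[i]^o]_n)).
apply: mx_continuous => i j /=.
have -> : (fun A : SU => (su_mx A^-1%g : 'M[R[i]^o]_n) i j) =
    (fun A : SU => Num.conj (su_mx A j i)).
  by apply/funext => A; rewrite /= !mxE.
move=> A; apply: (@continuous_comp SU R[i]^o R[i]^o
  (fun A => su_mx A j i) Num.conj); last exact: conj_continuous.
apply: (@continuous_comp SU 'M[R[i]^o]_n R[i]^o
  (@su_mx R n) (fun B => B j i)); first exact: su_mx_continuous.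
exact: (@mx_entry_continuous R[i]^o).
Qed.

HB.instance Definition _ := Group_isTopologicalGroup.Build SU
  su_mul_continuous su_inv_continuous.

End SpecialUnitaryTopology.

Notation "''SU_' n [ R ]" := (special_unitary R n)
  (at level 8, n at level 2, format "''SU_' n [ R ]") : type_scope.

Section Centralizer.
Variable G : groupType.
Implicit Types H K : set G.

Definition centralizer K : set G := [set g | forall k, K k -> commute g k].

Definition double_centralizer K := centralizer (centralizer K).

Definition howe_subgroup H := exists K, H = centralizer K.

End Centralizer.

(* For G a Lie group, the closed subgroups are the embedded Lie subgroups
   (Cartan). *)
Definition lie_subgroup (G : topologicalGroupType) (H : set G) :=
  [/\ H 1%g, forall g h, H g -> H h -> H (g * h)%g,
      forall g, H g -> H (g^-1)%g & closed H].

Definition homeomorphism_on (X Y : topologicalType) (A : set X) (B : set Y)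
    (f : X -> Y) (g : Y -> X) :=
  [/\ set_fun A B f /\ set_fun B A g, {in A, cancel f g}, {in B, cancel g f},
      {within A, continuous f} & {within B, continuous g}].

Definition topological_manifold (R : realType) (d : nat)
    (M : topologicalType) :=
  [/\ hausdorff_space M, @second_countable M &
    forall x : M, exists (U : set M) (V : set 'rV[R]_d) f g,
      [/\ open U, U x, open V & homeomorphism_on U V f g]].

(* [phi] and [psi] are mutually inverse homeomorphisms between [Q `&` proj @^-1` U], with the topology it has as a
   subspace of T, and [U `*` H].  Taking [Q = setT] and [H = setT] gives the
   local triviality of T itself. *)
Definition locally_trivial (G : topologicalGroupType) (M T : topologicalType)
    (proj : T -> M) (act : T -> G -> T) (H : set G) (Q : set T) :=
  forall x : M, exists (U : set M) (phi : T -> M * G) (psi : M * G -> T),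
    [/\ open U, U x,
        homeomorphism_on (Q `&` proj @^-1` U) (U `*` H) phi psi,
        (forall p, Q p -> U (proj p) -> (phi p).1 = proj p) &
        (forall p h, Q p -> U (proj p) -> H h ->
           phi (act p h) = ((phi p).1, (phi p).2 * h)%g)].

(* The action is free and transitive on the fibres by local triviality. *)
Record principal_bundle (G : topologicalGroupType) (M : topologicalType) :=
  PrincipalBundle {
    total :> topologicalType;
    proj : total -> M;
    act : total -> G -> total;
    proj_continuous : continuous proj;
    act_continuous : continuous (fun pg : total * G => act pg.1 pg.2);
    act1 : forall p, act p 1%g = p;
    actM : forall p g h, act p (g * h)%g = act (act p g) h;
    proj_act : forall p g, proj (act p g) = proj p;
    bundle_trivial : locally_trivial proj act [set: G] [set: total]
  }.

Section Reductions.
Variables (G : topologicalGroupType) (M : topologicalType).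
Variable P : principal_bundle G M.

(* Q is a principal subbundle of P with structure group H, as a subspace. *)
Definition reduction (H : set G) (Q : set P) :=
  [/\ lie_subgroup H,
      (forall p h, Q p -> H h -> Q (act p h)) &
      locally_trivial (@proj _ _ P) (@act _ _ P) H Q].

Definition howe_subbundle (Q : set P) :=
  exists2 H, howe_subgroup H & reduction H Q.

Definition holonomy_induced (Q : set P) :=
  exists (H' : set G) (Q' : set P),
    [/\ reduction H' Q', Q' `<=` Q, connected Q' &
        Q = [set act p g | p in Q' & g in double_centralizer H']].

End Reductions.

(* Main.v *)
Require Import Defs.
From mathcomp Require Import all_boot all_order all_algebra.
From mathcomp Require Import all_classical all_reals all_analysis.
From mathcomp Require Import complex ring.
Import Order.TTheory GRing.Theory Num.Theory numFieldNormedType.Exports.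

(* Let [Q0] be a connected component of [Q] and let [H0] be the subgroup of [H]
   preserving it.  Over a connected trivialising open set the slices
   [psi (W `*` {g})] are connected, so [Q0] meets each of them fully or not at
   all; hence [Q0] surjects onto [M] and is a reduction to [H0], which is closed
   because components are relatively closed.  By diagonalisation every element
   of [H] is a scalar multiple of one joined to [1] inside [H], and the latter
   lies in [H0].  So [H0] and [H] have the same centralizer, the double
   centralizer of [H0] is [H], and [Q = Q0 H]. *)

Set Implicit Arguments.
Unset Strict Implicit.
Unset Printing Implicit Defensive.

Local Open Scope classical_set_scope.
Local Open Scope ring_scope.

(** * Relative continuity, connected sets and components *)

Lemma within_nbhs (X Y : topologicalType) (A : set X) (f : X -> Y) x B :
  {within A, continuous f} -> A x -> nbhs (f x) B ->
  nbhs x [set y | A y -> B (f y)].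
Proof. by move=> /subspace_continuousP cf Ax /(cf x Ax). Qed.

Lemma within_continuous_comp (X Y Z : topologicalType) (A : set X) (B : set Y)
    (f : X -> Y) (g : Y -> Z) :
  set_fun A B f -> {within A, continuous f} -> {within B, continuous g} ->
  {within A, continuous (g \o f)}.
Proof.
move=> AB cf cg.
apply/subspace_continuousP => x Ax V /(within_nbhs cg (AB _ Ax)).
move=> /(within_nbhs cf Ax); rewrite /fmap /within /=.
by apply: filterS => y h Ay; apply: h => //; exact: AB.
Qed.

Lemma connected_within_image (X Y : topologicalType) (A B : set X)
    (f : X -> Y) :
  {within B, continuous f} -> A `<=` B -> connected A -> connected (f @` A).
Proof.
move=> cf AB cA; apply: connected_continuous_connected => //.
exact: continuous_subspaceW cf.
Qed.

(** A nonempty relatively clopen part of [B] meets [A], which is dense in [B], and so contains [A];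
    being relatively closed, it is all of [B]. *)
Lemma connected_squeeze (T : topologicalType) (A B : set T) :
  connected A -> A `<=` B -> B `<=` closure A -> connected B.
Proof.
move=> cA AB BA U [z Uz] [C1 oC1 E1] [C2 cC2 E2].
have AU : A `<=` U.
  have <- : A `&` U = A; last by apply: subIsetr.
  apply: cA.
  - move: Uz; rewrite E1 => -[Bz C1z].
    have [w [Aw C1w]] := BA _ Bz _ (open_nbhs_nbhs (conj oC1 C1z)).
    by exists w; split=> //; split=> //; exact: AB.
  - by exists C1 => //; rewrite E1 setIA (setIidl AB).
  - by exists C2 => //; rewrite E2 setIA (setIidl AB).
apply/seteqP; split; first by rewrite E1; exact: subIsetl.
move=> y By; rewrite E2; split => //.
have AC : A `<=` C2 by move=> w /AU; rewrite E2 => -[].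
by move/closure_id: cC2 => ->; exact: (closureS AC (BA _ By)).
Qed.

(** Adjoining a point of its closure keeps the component connected, so maximality applies. The
    component contains [x] because its closure, hence the component itself, is nonempty. *)
Lemma component_closed_in (T : topologicalType) (A : set T) x y :
  A y -> closure (connected_component A x) y -> connected_component A x y.
Proof.
move=> Ay Cy; set C := connected_component A x.
have Cx : C x.
  apply: contrapT => nCx; have [z [[D [Dx DA cD] Dz] _]] := Cy setT filterT.
  by apply: nCx; exists D.
apply: (connected_component_max (B := C `|` [set y])).
- by left.
- by move=> z [/connected_component_sub//|->].
- apply: connected_squeeze (@component_connected _ A x) _ _.
  + by move=> z; left.
  + by move=> z [/subset_closure//|->].
- by right.
Qed.

(** * Local connectedness of manifolds *)

Lemma mx_ball_connected (R : realType) m n (x : 'M[R]_(m, n)) (e : R) :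
  connected (ball x e).
Proof.
(* Membership in a matrix ball includes [0 < e], so the ball is empty otherwise, even for matrices
   without entries. *)
have [e0|e0] := ltP 0 e; last first.
  rewrite (_ : ball x e = set0); first exact: connected0.
  by apply/seteqP; split=> // y [ye _]; move: (le_lt_trans e0 ye); rewrite ltxx.
(* The ball is star-shaped: it is the union of the segments from [x] to its points, all of which
   share [x]. *)
pose seg y t : 'M[R]_(m, n) := x + t *: (y - x).
have -> : ball x e = \bigcup_(y in ball x e) (seg y @` `[0, 1]).
  apply/seteqP; split => [y xy|z [y [_ xy] [t /=]]].
    exists y => //; exists 1; first by rewrite /= in_itv /= lexx ler01.
    by rewrite /seg scale1r addrC subrK.
  rewrite in_itv /= => /andP[t0 t1] <-; split=> // i j.
  have := xy i j; rewrite -!ball_normE /= /seg !mxE opprD.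
  rewrite addrA subrr add0r normrN normrM (ger0_norm t0) distrC; apply: le_lt_trans.
  by rewrite ler_piMl.
apply: bigcup_connected => [|y xy].
  exists x => y _; exists 0; first by rewrite /= in_itv /= lexx ler01.
  by rewrite /seg scale0r addr0.
apply: connected_continuous_connected; first exact: segment_connected.
apply: continuous_subspaceT; apply: mx_continuous => i j t.
rewrite /seg (_ : (fun _ => _) = (fun t => x i j + t * (y i j - x i j))).
  by apply: cvgD; [exact: cvg_cst|apply: cvgM; [exact: cvg_id|exact: cvg_cst]].
by apply/funext => s; rewrite !mxE.
Qed.

Lemma mx_ball_open (R : realType) m n (x : 'M[R]_(m, n)) (e : R) :
  open (ball x e).
Proof.
rewrite openE => y [e0 xy].
exists (fun i j => ball (x i j) e) => [i j|z xz]; last by split.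
by apply: open_nbhs_nbhs; split; [exact: ball_open|exact: xy].
Qed.

Lemma manifold_locally_connected (R : realType) d (M : topologicalType)
    (x : M) (U : set M) :
  topological_manifold R d M -> open U -> U x ->
  exists W, [/\ open W, W x, W `<=` U & connected W].
Proof.
move=> [_ _ /(_ x)[U' [V [f [g [oU' U'x oV [[fUV gVU] fK gK cf cg]]]]]]] oU Ux.
have Vfx : V (f x) by exact: fUV.
have : nbhs (f x) (V `&` g @^-1` U).
  apply: filterI; first exact: open_nbhs_nbhs.
  have h : nbhs (f x) [set y | V y -> U (g y)].
    by apply: within_nbhs => //; rewrite fK ?inE //; exact: open_nbhs_nbhs.
  have /filterI /(_ h) : nbhs (f x) V by exact: open_nbhs_nbhs.
  by apply: filterS => y [Vy]; apply.
move=> /nbhs_ballP[e /= e0 eB].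
have eV : ball (f x) e `<=` V by move=> y /eB[].
have cB := connected_within_image cg eV (@mx_ball_connected R 1 d (f x) e).
(* As an image under the inverse chart [g] the set is connected; as a preimage under [f] inside [U']
   it is open. *)
have WE : g @` ball (f x) e = U' `&` f @^-1` ball (f x) e.
  apply/seteqP; split=> [_ [y xy <-]|y [U'y xy]].
    have Vy := eV _ xy; split; first exact: gVU.
    by rewrite /= gK ?inE.
  by exists (f y) => //; rewrite fK ?inE.
exists (g @` ball (f x) e); split => //.
- rewrite WE openE => y [U'y /= xy].
  have : nbhs (f y) (ball (f x) e).
    by apply: open_nbhs_nbhs; split => //; exact: mx_ball_open.
  move=> /(within_nbhs cf U'y) h.
  have /filterI /(_ h) : nbhs y U' by exact: open_nbhs_nbhs.
  by apply: filterS => z [Uz hz]; split => //; exact: hz.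
- by exists (f x); [exact: ballxx|rewrite fK ?inE].
- by move=> _ [y /eB[]/= _ ? <-].
Qed.

(** Left translation of the fibre coordinate commutes with the right action; it recentres a
    trivialisation in [component_reduction]. *)
Lemma shear_continuous (G : topologicalGroupType) (M : topologicalType) (g : G) :
  continuous (fun yg : M * G => (yg.1, g * yg.2)%g).
Proof.
move=> yh; apply: cvg_pair; first exact: cvg_fst.
apply: (continuous_comp (f := fun yg : M * G => (g, yg.2))
                        (g := fun ab => ab.1 * ab.2)%g).
  by apply: cvg_pair; [exact: cvg_cst|exact: cvg_snd].
exact: mulg_continuous.
Qed.

(** * The unit circle in [R[i]] *)

Section Cis.
Variable R : realType.
Implicit Types (s t : R) (z : R[i]).

Definition cis t : R[i] := Complex (cos t) (sin t).

Lemma cis0 : cis 0 = 1.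
Proof. by rewrite /cis cos0 sin0. Qed.

Lemma cisD s t : cis (s + t) = cis s * cis t.
Proof.
apply/eqP; rewrite eq_complex /= cosD sinD eqxx /=.
by apply/eqP; ring.
Qed.

Lemma cis_sum (I : finType) (f : I -> R) :
  cis (\sum_i f i) = \prod_i cis (f i).
Proof. by apply: (big_morph cis cisD cis0). Qed.

Lemma norm_cis t : `|cis t| = 1.
Proof. by rewrite normc_def /= cos2Dsin2 sqrtr1. Qed.

(** The argument is [acos x] or its opposite according to the sign of [y], since the sine of
    [acos x] is the absolute value of [y]. *)
Lemma norm1_cis z : `|z| = 1 -> exists t, cis t = z.
Proof.
case: z => x y nz.
have xy : x ^+ 2 + y ^+ 2 = 1.
  apply: (@complexI R); rewrite -[RHS]/(1 : R[i]).
  by rewrite (add_Re2_Im2 (Complex x y)) nz expr1n.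
have x1 : -1 <= x <= 1 by rewrite -ler_norml -(@ler_pXn2r _ 2) ?nnegrE // expr1n
    -normrX ger0_norm ?sqr_ge0 // -xy lerDl sqr_ge0.
have xs : Num.sqrt (1 - x ^+ 2) = `|y| by rewrite -xy addrC addKr sqrtr_sqr.
have cx : cos (acos x) = x by apply: acosK.
have [y0|y0] := leP 0 y.
  by exists (acos x); rewrite /cis cx sin_acos // xs ger0_norm.
exists (- acos x).
by rewrite /cis cosN sinN cx sin_acos // xs ltr0_norm // opprK.
Qed.

Lemma real_complex_continuous : continuous (real_complex R : R -> R[i]^o).
Proof.
move=> x A [e /= e0 xA].
(* Positive elements of [R[i]] are real, so [e] yields a radius in [R]. *)
have [e1 e2] : e = (complex.Re e)%:C%C /\ 0 < complex.Re e.
  by case: e e0 {xA} => a b; rewrite ltcE /= => /andP[/eqP -> ?].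
exists (complex.Re e) => //= y xy; apply: xA.
rewrite /ball_ /= -rmorphB normc_def /= expr0n addr0 sqrtr_sqr e1 ltcR.
exact: xy.
Qed.

Lemma cis_continuous : continuous (cis : R -> R[i]^o).
Proof.
have -> : cis = (fun t => (cos t)%:C%C + 'i%C * (sin t)%:C%C : R[i]^o).
  by apply/funext => t; rewrite [LHS]complexE.
move=> t; apply: (@cvgD _ R[i]^o).
  by apply: (continuous_comp (f := cos));
    [exact: continuous_cos|exact: real_complex_continuous].
apply: (@cvgM R[i]); first exact: cvg_cst.
by apply: (continuous_comp (f := sin));
    [exact: continuous_sin|exact: real_complex_continuous].
Qed.
End Cis.

(** * Matrices diagonalised by a fixed unitary matrix *)

Section SpectralPath.
Variables (R : realType) (n : nat).
Local Open Scope sesquilinear_scope.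
Local Notation C := R[i].
Variable P : 'M[C]_n.
Hypothesis uP : P \is unitarymx.

(** The eigenvalues form a function [d], so that functional calculus is the composition [f \o d]
    with the eigenbasis [P] kept fixed. *)
Definition conj_diag (d : 'I_n -> C) : 'M[C]_n :=
  P^t* *m diag_mx (\row_i d i) *m P.

Lemma conj_diag_entry d i j :
  conj_diag d i j = \sum_k Num.conj (P k i) * d k * P k j.
Proof.
rewrite /conj_diag mxE; apply: eq_bigr => k _.
by rewrite mul_mx_diag !mxE.
Qed.

Lemma conj_diagZ a d : conj_diag (fun i => a * d i) = a *: conj_diag d.
Proof.
apply/matrixP => i j; rewrite [RHS]mxE !conj_diag_entry mulr_sumr.
by apply: eq_bigr => k _; ring.
Qed.

Lemma conj_diagK d : P *m conj_diag d *m P^t* = diag_mx (\row_i d i).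
Proof.
have PP : P *m P^t* = 1%:M by exact/unitarymxP.
by rewrite /conj_diag !mulmxA PP mul1mx -mulmxA PP mulmx1.
Qed.

Lemma conj_diag1 : conj_diag (fun _ => 1) = 1%:M.
Proof.
rewrite /conj_diag (_ : \row_i 1 = const_mx 1); last first.
  by apply/rowP => i; rewrite !mxE.
by rewrite diag_const_mx mulmx1; apply: mulmx1C; apply/unitarymxP.
Qed.

Lemma unitary_diag d :
  (forall i, `|d i| = 1) -> diag_mx (\row_i d i : 'rV[C]_n) \is unitarymx.
Proof.
move=> d1; apply/unitarymxP/matrixP => i j.
rewrite mul_diag_mx !mxE; case: eqVneq => [->|ij].
  by rewrite mulr1n -normCK d1 expr1n.
by rewrite mulr0n conjC0 mulr0.
Qed.

Lemma unitary_conj_diag d : (forall i, `|d i| = 1) -> conj_diag d \is unitarymx.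
Proof.
move=> d1; apply: mul_unitarymx => //.
apply: mul_unitarymx; last exact: unitary_diag.
by rewrite trmxC_unitary.
Qed.

Lemma unitary_conj_diag_norm d i : conj_diag d \is unitarymx -> `|d i| = 1.
Proof.
move=> ud; have : diag_mx (\row_i d i) \is unitarymx.
  by rewrite -conj_diagK; apply: mul_unitarymx;
    [exact: mul_unitarymx|rewrite trmxC_unitary].
move=> /unitarymxP/matrixP/(_ i i); rewrite mul_diag_mx !mxE eqxx !mulr1n
  -normCK => d2.
by apply/eqP; rewrite -(@pexpr_eq1 _ _ 2) // d2.
Qed.

Lemma det_conj_diag d : \det (conj_diag d) = \prod_i d i.
Proof.
have PP : P *m P^t* = 1%:M by exact/unitarymxP.
rewrite /conj_diag !det_mulmx mulrAC -det_mulmx (mulmx1C PP) det1 mul1r.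
rewrite det_diag.
by apply: eq_bigr => i _; rewrite mxE.
Qed.

(* Entrywise, [A] commutes with a diagonal matrix iff it preserves its
   eigenspaces; applying [f] can only merge eigenspaces. *)
Lemma comm_conj_diag (f : C -> C) d A :
  comm_mx A (conj_diag d) -> comm_mx A (conj_diag (f \o d)).
Proof.
rewrite /comm_mx => cA.
have PP : P *m P^t* = 1%:M by exact/unitarymxP.
have PP' : P^t* *m P = 1%:M by exact: mulmx1C.
have cK X : P *m (P^t* *m X *m P) *m P^t* = X.
  by rewrite !mulmxA PP mul1mx -mulmxA PP mulmx1.
have cM X Y : (P^t* *m X *m P) *m (P^t* *m Y *m P) = P^t* *m (X *m Y) *m P.
  by rewrite !mulmxA -(mulmxA _ P (P^t*)) PP mulmx1.
(* [B] is [A] in the eigenbasis. Commutation reads [B i j * (d j - d i) = 0], so [B i j] vanishes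
   unless the two eigenvalues agree. *)
set B := P *m A *m P^t*.
have AB : P^t* *m B *m P = A.
  by rewrite /B !mulmxA PP' mul1mx -mulmxA PP' mulmx1.
clearbody B.
have cB : B *m diag_mx (\row_i d i) = diag_mx (\row_i d i) *m B.
  by rewrite -[LHS]cK -[RHS]cK -!cM AB -/(conj_diag d) cA.
have cfB : B *m diag_mx (\row_i f (d i)) = diag_mx (\row_i f (d i)) *m B.
  apply/matrixP => i j; move/matrixP/(_ i j): cB.
  rewrite !mul_mx_diag !mul_diag_mx !mxE.
  have [->|dij] := eqVneq (d i) (d j); first by move=> _; rewrite mulrC.
  move=> /eqP; rewrite [X in _ == X]mulrC -subr_eq0 -mulrBr mulf_eq0 subr_eq0.
  by rewrite [d j == _]eq_sym (negPf dij) orbF => /eqP ->; rewrite mul0r mulr0.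
by rewrite -AB !cM cfB.
Qed.

End SpectralPath.

(** * Paths inside centralizers in the special unitary group *)

Section CentralizerPath.
Variables (R : realType) (n : nat).
Local Open Scope sesquilinear_scope.
Local Notation C := R[i].
Local Notation SU := 'SU_n[R].

Lemma commute_su (u v : SU) : commute u v <-> comm_mx (su_mx u) (su_mx v).
Proof. by split=> [/(congr1 (@su_mx R n))|] //= uv; apply: val_inj. Qed.

Lemma su_path_continuous (w : R -> SU) :
  (forall i j, continuous (fun t => su_mx (w t) i j : R[i]^o)) -> continuous w.
Proof.
move=> cw; apply: (@continuous_comp_initial _ _ _
  (@su_mx R n : SU -> 'M[R[i]^o]_n)).
exact: mx_continuous.
Qed.

(* Diagonalise [u] as [diag (exp (i a_j))], with [a_j] a function of the
   eigenvalue, and let [m] be the mean of the [a_j].  The path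
   [diag (exp (i t (a_j - m)))] has determinant 1 and stays in the centralizer;
   at [t = 1] it is [u] up to the scalar [exp (- i m)]. *)
Lemma centralizer_path (K : set SU) (u : SU) : centralizer K u ->
  exists (E : set SU) (v : SU),
    [/\ connected E, E `<=` centralizer K, E 1%g, E v &
        forall c, commute c v -> commute c u].
Proof.
move=> Ku.
have uu : su_mx u \is unitarymx by case: u {Ku} => u /= /andP[].
have /orthomx_spectralP : su_mx u \is normalmx.
  apply/normalmxP; rewrite (unitarymxP uu); apply/esym/mulmx1C.
  exact/unitarymxP.
set P := spectralmx _; set D := spectral_diag _ => uE.
have uP : P \is unitarymx by exact: spectral_unitarymx.
have {}uE : su_mx u = conj_diag P (D 0).
  rewrite uE invmx_unitary //; congr (_ *m diag_mx _ *m _).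
  by apply/rowP => i; rewrite mxE.
have nD i : `|D 0 i| = 1.
  by apply: (@unitary_conj_diag_norm _ _ P uP (D 0)); rewrite -uE.
(* One angle is chosen per complex number, not per index, so that equal eigenvalues get equal angles
   and [comm_conj_diag] applies. *)
have [ang angE] : exists ang : C -> R, forall z, `|z| = 1 -> cis (ang z) = z.
  have /choice[a aE] : forall z : C, exists t, `|z| = 1 -> cis t = z.
    move=> z; have [/norm1_cis[t tz]|nz] := pselect (`|z| = 1); first by exists t.
    by exists 0.
  by exists a.
pose m := (\sum_i ang (D 0 i)) / n%:R.
pose f t z := cis (t * (ang z - m)).
have f_cont z : continuous (f^~ z : R -> C^o).
  move=> t; have ct : {for t, continuous (fun s : R => s * (ang z - m))}.
    by apply: cvgM; [exact: cvg_id|exact: cvg_cst].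
  exact: (continuous_comp ct (@cis_continuous R _)).
pose W t := conj_diag P (f t \o D 0).
have WP t : (W t \is unitarymx) && (\det (W t) == 1).
  apply/andP; split; first by apply: unitary_conj_diag => // i; exact: norm_cis.
  rewrite det_conj_diag //= -cis_sum -mulr_sumr sumrB sumr_const card_ord.
  (* The mean satisfies [m * n = \sum_i ang (D 0 i)] when [n] is positive; for [n = 0] the sum is
     empty and both terms vanish. *)
  rewrite /m -[X in _ - X]mulr_natr; case: (posnP n) => [n0|n0].
    rewrite big1 ?mul0r ?subrr ?mulr0 ?cis0 // => i.
    by have := ltn_ord i; rewrite {2}n0.
  by rewrite mulfVK ?subrr ?mulr0 ?cis0 // pnatr_eq0 -lt0n.
pose w t : SU := SpecialUnitary (WP t).
exists (w @` setT), (w 1); split.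
- apply: connected_continuous_connected; first by apply/connected_intervalP.
  apply: continuous_subspaceT; apply: su_path_continuous => i j.
  rewrite /= /W (_ : (fun _ => _) =
      (fun t => \sum_k Num.conj (P k i) * f t (D 0 k) * P k j)); last first.
    by apply/funext => t; rewrite conj_diag_entry.
  apply: continuous_big => [|k _ t]; first exact: (@add_continuous C^o).
  apply: (@cvgM C); last exact: cvg_cst.
  apply: (@cvgM C); first exact: cvg_cst.
  exact: f_cont.
(* Each [w t] is a function of [u], so it commutes with whatever commutes with [u]. *)
- move=> _ [t _ <-] k Kk; apply/commute_su/comm_mx_sym/comm_conj_diag => //.
  by rewrite -uE; apply/comm_mx_sym/commute_su; exact: Ku.
- exists 0 => //; apply: val_inj => /=; rewrite /W -[RHS](conj_diag1 uP).
  by congr conj_diag; apply/funext => i; rewrite /= /f mul0r cis0.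
- by exists 1.
- move=> c /commute_su; rewrite /= => cw; apply/commute_su.
  suff -> : su_mx u = cis m *: W 1 by rewrite /comm_mx -scalemxAr -scalemxAl cw.
  rewrite uE -conj_diagZ; congr conj_diag; apply/funext => i.
  by rewrite /= /f mul1r -cisD addrC subrK angE.
Qed.

End CentralizerPath.

(** * A connected component of a reduction is a reduction *)

Section PrincipalComponent.
Variables (G : topologicalGroupType) (M : topologicalType).
Variable P : principal_bundle G M.
Local Notation pi := (@Defs.proj _ _ P).
Local Notation act := (@act _ _ P).

Lemma act_continuous_l (g : G) : continuous (act^~ g).
Proof.
move=> p; apply: (continuous_comp (f := fun p => (p, g))
                               (g := fun pg => act pg.1 pg.2)).
  by apply: cvg_pair; [exact: cvg_id|exact: cvg_cst].
exact: act_continuous.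
Qed.

Lemma act_continuous_r (p : P) : continuous (act p).
Proof.
move=> g; apply: (continuous_comp (f := fun g => (p, g))
                               (g := fun pg => act pg.1 pg.2)).
  by apply: cvg_pair; [exact: cvg_cst|exact: cvg_id].
exact: act_continuous.
Qed.

Variables (H : set G) (Q : set P).
Hypothesis rQ : reduction H Q.

Let H1 : H 1%g. Proof. by case: rQ => -[]. Qed.
Let HM g h : H g -> H h -> H (g * h)%g.
Proof. by case: rQ => -[_ + _ _ _ _]; apply. Qed.
Let HV g : H g -> H g^-1%g. Proof. by case: rQ => -[_ _ + _ _ _]; apply. Qed.
Let Qact p h : Q p -> H h -> Q (act p h). Proof. by case: rQ => _ + _; apply. Qed.

(** In a trivialisation of [Q] the fibre coordinates of [p] and [q] lie in [H], and [h] is their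
    quotient. *)
Lemma reduction_transitive p q : Q p -> Q q -> pi p = pi q ->
  exists2 h, H h & q = act p h.
Proof.
move=> Qp Qq pq; have [_ _ /(_ (pi p))] := rQ.
move=> [U [phi [psi [oU Up [[fQ gQ] phiK psiK _ _] phi1 phiM]]]].
have [_ Hp] : (U `*` H) (phi p) by exact: fQ.
have [_ Hq] : (U `*` H) (phi q) by apply: fQ; split=> //; rewrite /= -pq.
pose h := ((phi p).2^-1 * (phi q).2)%g.
have Hh : H h by apply: HM => //; exact: HV.
exists h => //; rewrite -[LHS]phiK ?inE //; last by split=> //; rewrite /= -pq.
rewrite -[RHS]phiK ?inE //; last by split; [exact: Qact|rewrite /= proj_act].
rewrite phiM // /h mulgA mulgV mul1g phi1 // pq -phi1 -?pq //.
by case: (phi q).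
Qed.

Lemma connected_act (A : set P) g : connected A -> connected (act^~ g @` A).
Proof.
move=> cA; apply: connected_continuous_connected => //.
by apply: continuous_subspaceT; exact: act_continuous_l.
Qed.

Variable p0 : P.
Hypothesis Qp0 : Q p0.

Let Q0 := connected_component Q p0.
(** The stabiliser of the component in [H], tested at [p0] only; [component_act] shows that any
    point of the component gives the same condition. *)
Definition component_group : set G := [set h | H h /\ Q0 (act p0 h)].

Lemma component_sub_connected (A : set P) p :
  connected A -> A `<=` Q -> A p -> Q0 p -> A `<=` Q0.
Proof.
move=> cA AQ Ap Qp q Aq; apply: connected_component_trans Qp _.
exact: (connected_component_max Ap).
Qed.

(** Translation by [h] maps the component onto a connected subset of [Q]; if one point stays in the
    component, the whole image does. *)
Lemma component_act p h : Q0 p -> H h -> Q0 (act p h) <-> component_group h.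
Proof.
have QQ : Q0 `<=` Q by exact: connected_component_sub.
have tr g q : H g -> Q0 q -> Q0 (act q g) -> forall r, Q0 r -> Q0 (act r g).
  move=> Hg Qq Qqg r Qr.
  apply: (@component_sub_connected (act^~ g @` Q0) (act q g)) => //.
  - by apply: connected_act; exact: component_connected.
  - by move=> _ [s Qs <-]; apply: Qact => //; exact: QQ.
  - by exists q.
  - by exists r.
have Q00 : Q0 p0 by exact: connected_component_refl.
move=> Qp Hh; split => [Qph|[_ Qh]]; last exact: tr Qh _ Qp.
by split => //; exact: tr Qph _ Q00.
Qed.

Lemma component_lie_subgroup : lie_subgroup component_group.
Proof.
have Q00 : Q0 p0 by exact: connected_component_refl.
split.
- by split => //; rewrite act1.
- move=> g h [Hg Qg] hh; have [Hh _] := hh; split; first exact: HM.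
  by rewrite actM; apply/component_act.
(* The test is made at [act p0 g], which the inverse of [g] sends back to [p0]. *)
- move=> g gg; have [Hg Qg] := gg; apply/(component_act Qg); first exact: HV.
  by rewrite -actM mulgV act1.
(* Closedness of [H] gives [H h]; then [act p0 h] lies in [Q] and in the closure of [Q0], hence in
   [Q0]. *)
- move=> h ch; have [[_ _ _ cH] _ _] := rQ.
  have Hh : H h by apply: cH; apply: closureS ch => g [].
  split => //; apply: component_closed_in; first exact: Qact.
  move=> B /(@act_continuous_r p0 h) /ch[g [[_ Qg] Bg]].
  by exists (act p0 g).
Qed.

Hypothesis M_locally_connected : forall (x : M) (U : set M),
  open U -> U x -> exists W, [/\ open W, W x, W `<=` U & connected W].
Hypothesis M_connected : connected [set: M].

(** The trivialisation is restricted to a connected [W], so that [psi] maps each horizontal slice to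
    a connected subset of [Q]. *)
Lemma component_slice (x : M) : exists (W : set M) phi psi,
  [/\ open W, W x, homeomorphism_on (Q `&` pi @^-1` W) (W `*` H) phi psi,
      (forall p, Q p -> W (pi p) -> (phi p).1 = pi p) /\
      (forall p h, Q p -> W (pi p) -> H h ->
           phi (act p h) = ((phi p).1, (phi p).2 * h)%g) &
      forall y z g, W y -> W z -> H g -> Q0 (psi (y, g)) -> Q0 (psi (z, g))].
Proof.
have [_ _ /(_ x)] := rQ.
move=> [U [phi [psi [oU Ux [[fQ gQ] phiK psiK cphi cpsi] phi1 phiM]]]].
have [W [oW Wx WU cW]] := M_locally_connected oU Ux.
have sQ : Q `&` pi @^-1` W `<=` Q `&` pi @^-1` U by move=> p [Qp /WU].
have sH : W `*` H `<=` U `*` H by move=> p [/WU].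
have psiW y g : W y -> H g -> Q (psi (y, g)) /\ pi (psi (y, g)) = y.
  move=> Wy Hg; have [Qy Uy] := gQ (y, g) (sH (y, g) (conj Wy Hg)).
  by split => //; rewrite -phi1 // psiK // inE; split => //; exact: WU.
exists W, phi, psi; split => //.
- split.
  + split=> [p [Qp Wp]|[y g] [Wy Hg]].
      have [_ ?] := fQ p (sQ p (conj Qp Wp)).
      by split => //; rewrite phi1 //; exact: WU.
    by have [? e] := psiW _ _ Wy Hg; split; rewrite //= e.
  + by move=> p; rewrite inE => /sQ Qp; apply: phiK; rewrite inE.
  + by move=> p; rewrite inE => /sH Qp; apply: psiK; rewrite inE.
  + exact: continuous_subspaceW cphi.
  + exact: continuous_subspaceW cpsi.
- by split=> [p Qp /WU|p h Qp /WU]; [exact: phi1|exact: phiM].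
move=> y z g Wy Wz Hg Qyg.
have cA : connected [set (y, g) | y in W].
  apply: connected_continuous_connected => //; apply: continuous_subspaceT => t.
  by apply: cvg_pair; [exact: cvg_id|exact: cvg_cst].
have AU : [set (y, g) | y in W] `<=` U `*` H by move=> _ [t /WU Ut <-].
have cB := connected_within_image cpsi AU cA.
apply: (component_sub_connected cB _ _ Qyg).
- by move=> _ [_ [t Wt <-] <-]; have [] := psiW t g Wt Hg.
- by exists (y, g) => //; exists y.
- by exists (z, g) => //; exists z.
Qed.

(** By sliding along slices, the projection of [Q0] contains all or none of a neighbourhood of each
    point; it is thus clopen and nonempty. *)
Lemma component_proj_surj x : exists2 p, Q0 p & pi p = x.
Proof.
have Q0Q : Q0 `<=` Q by exact: connected_component_sub.
have all_or_none y : exists W, [/\ open W, W y &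
    forall z t, W z -> W t -> (pi @` Q0) z -> (pi @` Q0) t].
  have [W [phi [psi [oW Wy [[fQ gQ] phiK psiK _ _] [phi1 _] sl]]]] :=
    component_slice y.
  exists W; split => // z t Wz Wt [p Qp pz].
  have [Wp Hp] := fQ p (conj (Q0Q _ Qp) (eq_ind_r W Wz pz)).
  have QWp : (Q `&` pi @^-1` W) p by split; [exact: Q0Q|rewrite /= pz].
  exists (psi (t, (phi p).2)).
    apply: (sl (phi p).1) => //; rewrite -surjective_pairing phiK ?inE //.
  have Wtp : (W `*` H) (t, (phi p).2) by [].
  by have [Qt Wpt] := gQ _ Wtp; rewrite -phi1 // psiK ?inE.
suff E : pi @` Q0 = setT.
  by have [p Qp px] : (pi @` Q0) x; [rewrite E|exists p].
apply: M_connected.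
- by exists (pi p0); exists p0 => //; exact: connected_component_refl.
- exists (pi @` Q0); last by rewrite setTI.
  rewrite openE => y Qy; have [W [oW Wy h]] := all_or_none y.
  apply: filterS (open_nbhs_nbhs (conj oW Wy)) => z Wz; exact: h Qy.
- exists (pi @` Q0); last by rewrite setTI.
  move=> y cy; have [W [oW Wy h]] := all_or_none y.
  by have [z [Qz Wz]] := cy W (open_nbhs_nbhs (conj oW Wy)); exact: h Qz.
Qed.

(** Over [W] the fibre coordinates of points of [Q0] form a left coset of [component_group].
    Dividing by a representative [g0] on the left turns it into the group and preserves
    equivariance. *)
Lemma component_reduction : reduction component_group Q0.
Proof.
have Q0Q : Q0 `<=` Q by exact: connected_component_sub.
split; first exact: component_lie_subgroup.
  by move=> p h Qp hh; have [Hh _] := hh; apply/component_act.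
move=> x.
have [W [phi [psi [oW Wx [[fQ gQ] phiK psiK cphi cpsi] [phi1 phiM] sl]]]] :=
  component_slice x.
have [q0 Qq0 q0x] := component_proj_surj x.
have Wq0 : W (pi q0) by rewrite q0x.
have [_ Hg0] := fQ q0 (conj (Q0Q _ Qq0) Wq0).
(* The representative is the fibre coordinate of a point of [Q0] over [x]. *)
set g0 := (phi q0).2 in Hg0.
have Qx0 : Q0 (psi (x, g0)).
  rewrite -q0x -phi1 ?/g0 -?surjective_pairing ?phiK ?inE //; last exact: Q0Q.
  by split => //; exact: Q0Q.
have psiM y g h : W y -> H g -> H h -> psi (y, g * h)%g = act (psi (y, g)) h.
  move=> Wy Hg Hh; have [Qy Wpy] := gQ (y, g) (conj Wy Hg).
  rewrite -[RHS]phiK ?inE; last by split; [exact: Qact|rewrite /= proj_act].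
  by rewrite phiM // psiK // inE.
have hgroup h : component_group h -> H h by case.
have psiQ y h : W y -> H h -> Q0 (psi (y, g0 * h)%g) <-> component_group h.
  move=> Wy Hh; rewrite psiM //; apply: component_act => //.
  exact: sl Qx0.
exists W, (fun p => ((phi p).1, g0^-1 * (phi p).2)%g),
  (fun yh => psi (yh.1, g0 * yh.2)%g).
split => //; last 2 first.
- by move=> p Qp Wp /=; apply: phi1 => //; exact: Q0Q.
- move=> p h Qp Wp hh /=; rewrite phiM //=;
    [by rewrite mulgA|exact: Q0Q|exact: hgroup].
have sQ : Q0 `&` pi @^-1` W `<=` Q `&` pi @^-1` W by move=> p [/Q0Q].
have psi_fst y g : W y -> H g -> pi (psi (y, g)) = y.
  move=> Wy Hg; have [Qy Wpy] := gQ (y, g) (conj Wy Hg).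
  by rewrite -phi1 // psiK // inE.
split.
- split=> [p Qp|[y h] [/= Wy hh]].
    have [Wp Hp] := fQ p (sQ p Qp); split => //=.
    apply/(psiQ (phi p).1) => //; first by apply: HM => //; exact: HV.
    rewrite mulgA mulgV mul1g -surjective_pairing phiK ?inE; last exact: sQ.
    by case: Qp.
  have Hh := hgroup _ hh; split; first exact/psiQ.
  by rewrite /= psi_fst //; exact: HM.
- move=> p; rewrite inE => Qp /=.
  by rewrite mulgA mulgV mul1g -surjective_pairing phiK // inE; exact: sQ.
- move=> [y h]; rewrite inE => -[/= Wy hh]; rewrite psiK /=.
    by rewrite mulgA mulVg mul1g.
  by rewrite inE; split => //=; apply: HM => //; exact: hgroup.
- apply: (@within_continuous_comp _ _ _ _ setT phi
    (fun yg => (yg.1, g0^-1 * yg.2)%g)) => //.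
    exact: continuous_subspaceW cphi.
  by apply: continuous_subspaceT; exact: shear_continuous.
- apply: (within_continuous_comp (B := W `*` H)
    (f := fun yg => (yg.1, g0 * yg.2)%g)) cpsi.
    move=> [y h] [/= Wy hh]; split => //=; apply: HM => //; exact: hgroup.
  by apply: continuous_subspaceT; exact: shear_continuous.
Qed.

End PrincipalComponent.

(** * Howe subbundles are generated by a component *)

Theorem theorem6p2 (R : realType) (d n : nat) (M : topologicalType)
    (P : principal_bundle 'SU_n[R] M) (Q : set P) :
  topological_manifold R d M -> connected [set: M] ->
  howe_subbundle Q -> holonomy_induced Q.
Proof.
move=> mM cM [H [K HK] rQ].
(* An empty [Q] is its own connected subbundle, with group [H]. *)
have [Q0|/set0P[p0 Qp0]] := eqVneq Q set0.
  exists H, Q; split => //; rewrite Q0; first exact: connected0.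
  by apply/seteqP; split=> // q [p [] ].
pose Q' := connected_component Q p0.
have Q'Q : Q' `<=` Q by exact: connected_component_sub.
have lc := fun x U => @manifold_locally_connected R d M x U mM.
pose H' := component_group H Q p0.
exists H', Q'; split => //.
- exact: component_reduction.
- exact: component_connected.
(* For [u] in [H], the path from [1] to [v] moves [p0] inside its component, so [v] lies in [H'].
   What centralizes [H'] commutes with [v], hence with [u]. *)
have CH' c : centralizer H' c -> centralizer H c.
  move=> cH' u; rewrite {1}HK => /centralizer_path[E [v [cE EK E1 Ev]]]; apply.
  apply: cH'; split; first by rewrite HK; exact: EK.
  have cpE : connected (act p0 @` E).
    apply: connected_continuous_connected => //.
    by apply: continuous_subspaceT; exact: act_continuous_r.
  have [_ Qact _] := rQ.
  apply: (connected_component_max (B := act p0 @` E)) => //.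
  - by exists 1%g; rewrite ?act1.
  - by move=> _ [g /EK Eg <-]; apply: Qact => //; rewrite HK.
(* Since [H'] lies in [H], the centralizer of [K], every element of [K] centralizes [H']; so the
   double centralizer of [H'] centralizes [K]. The converse is [CH']. *)
have CC : double_centralizer H' = H.
  apply/seteqP; split => [g gC|h Hh c /CH' cH].
    rewrite HK => k Kk; apply: gC => h [+ _].
    by rewrite HK => /(_ k Kk) hk; exact: commute_sym.
  by apply: commute_sym; exact: cH.
rewrite CC; apply/seteqP; split => [q Qq|_ [p /Q'Q Qp [h Hh <-]]]; last first.
  by have [_ Qact _] := rQ; exact: Qact.
(* The component meets the fibre of [q], and [H] is transitive on the fibres of [Q]. *)
have [p Q'p pq] := component_proj_surj rQ Qp0 lc cM (Defs.proj q).
have [h Hh ->] := reduction_transitive rQ (Q'Q _ Q'p) Qq pq.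
by exists p => //; exists h.
Qed.
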